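(* There are exactly $16$ isomorphism classes of two-dimensional reflexive polytopes. They are represented, with respect to the lattice $\mathbb Z^2$, by the following polygons (the number in each label is the number of lattice points on the boundary): - 3: $\mathrm{conv}((1,0),(0,1),(-1,-1))$; - 4a: $\mathrm{conv}((1,0),(0,1),(-1,0),(0,-1))$; - 4b: $\mathrm{conv}((-1,1),(0,1),(1,0),(0,-1))$; - 4c: $\mathrm{conv}((-1,1),(1,1),(0,-1))$; - 5a: $\mathrm{conv}((-1,1),(0,1),(1,0),(0,-1),(-1,0))$; - 5b: $\mathrm{conv}((-1,1),(1,1),(1,0),(0,-1))$; - 6a: $\mathrm{conv}((-1,1),(0,1),(1,0),(1,-1),(0,-1),(-1,0))$; - 6b: $\mathrm{conv}((-1,1),(1,1),(1,0),(0,-1),(-1,0))$; - 6c: $\mathrm{conv}((-1,1),(1,1),(1,-1),(0,-1))$; - 6d: $\mathrm{conv}((-1,1),(1,1),(1,-2))$; - 7a: $\mathrm{conv}((-1,1),(1,1),(1,0),(0,-1),(-1,-1))$; - 7b: $\mathrm{conv}((-1,1),(1,1),(1,-2),(0,-1))$; - 8a: $\mathrm{conv}((-1,1),(1,1),(1,-1),(-1,-1))$; - 8b: $\mathrm{conv}((-1,1),(1,1),(1,-2),(-1,0))$; - 8c: $\mathrm{conv}((-1,1),(1,1),(1,-3))$; - 9: $\mathrm{conv}((-1,1),(-1,-2),(2,1))$.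
   Context: Let $M\cong\mathbb Z^2$ be a lattice with dual lattice $N$. A two-dimensional reflexive polytope is a two-dimensional lattice polytope $P\subseteq M_{\mathbb R}$ (vertices in $M$) with $0\in\mathrm{int}\,P$ whose dual $P^*=\{y\in N_{\mathbb R}:\langle x,y\rangle\ge -1\ \forall x\in P\}$ is a lattice polytope. An isomorphism of lattice polytopes is an isomorphism of the lattices whose real linear extension maps one polytope onto the other. *)

(* Defs.v *)
From mathcomp Require Import all_boot all_order all_algebra.
From mathcomp Require Import all_classical all_reals all_analysis.

Set Implicit Arguments.
Unset Strict Implicit.
Unset Printing Implicit Defensive.

Import Order.TTheory GRing.Theory Num.Theory.
Import numFieldNormedType.Exports.

Local Open Scope classical_set_scope.
Local Open Scope card_scope.
Local Open Scope ring_scope.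

Section Polytopes.
Variables (R : realType) (V : lmodType R).

Definition conv_hull (A : set V) : set V :=
  smallest (fun C : set V => convex_set (C : set (convex_lmodType V))) A.

Definition polytope (P : set V) := exists s : seq V, P = conv_hull [set` s].

(* Vertices are taken to be the extreme points. *)
Definition vertex (P : set V) (v : V) :=
  P v /\ forall (x y : V) (t : R), P x -> P y -> 0 < t < 1 ->
    v = t *: x + (1 - t) *: y -> x = v /\ y = v.

Definition lattice_polytope (L P : set V) :=
  polytope P /\ vertex P `<=` L.

End Polytopes.

Section Reflexive.
Variable R : realType.

(* M_R is modelled as row vectors and N_R as column vectors; the pairing is
   the matrix product. A lattice M in M_R is the Z-span of any R-basis, given
   by the rows of an invertible matrix. *)
Definition integer_span (B : 'M[R]_2) : set 'rV[R]_2 :=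
  [set map_mx intr z *m B | z in [set: 'rV[int]_2]].

Definition is_lattice (M : set 'rV[R]_2) :=
  exists2 B : 'M[R]_2, B \in unitmx & M = integer_span B.

Definition Z2 : set 'rV[R]_2 := integer_span 1%:M.

Definition pairing (x : 'rV[R]_2) (y : 'cV[R]_2) : R := (x *m y) 0 0.

Definition dual_lattice (M : set 'rV[R]_2) : set 'cV[R]_2 :=
  [set y | forall x, M x -> pairing x y \is a Num.int].

Definition dual_polytope (P : set 'rV[R]_2) : set 'cV[R]_2 :=
  [set y | forall x, P x -> -1 <= pairing x y].

Definition two_dimensional (P : set 'rV[R]_2) :=
  exists a b c, [/\ P a, P b, P c & \rank (col_mx (b - a) (c - a)) = 2%N].

(* A polytope is always considered together with the lattice M it lives in. *)
Definition lattice_pair := (set 'rV[R]_2 * set 'rV[R]_2)%type.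

Definition reflexive_polygon : set lattice_pair :=
  [set MP : lattice_pair | let: (M, P) := MP in
    [/\ is_lattice M, lattice_polytope M P, two_dimensional P,
        P° 0 & lattice_polytope (dual_lattice M) (dual_polytope P)]].

(* f is the real linear extension of its restriction, a lattice isomorphism M -> M'. *)
Definition isomorphic (MP MP' : lattice_pair) :=
  exists f : {linear 'rV[R]_2 -> 'rV[R]_2},
    set_bij MP.1 MP'.1 f /\ f @` MP.2 = MP'.2.

Definition iso_class (MP : lattice_pair) : set lattice_pair :=
  [set MP' | reflexive_polygon MP' /\ isomorphic MP MP'].

Definition iso_classes : set (set lattice_pair) :=
  iso_class @` reflexive_polygon.

Definition boundary (P : set 'rV[R]_2) : set 'rV[R]_2 := closure P `\` P°.

End Reflexive.

Arguments lattice_pair R : clear implicits.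
Arguments Z2 R : clear implicits.
Arguments iso_classes R : clear implicits.

Inductive label :=
  | L3 | L4a | L4b | L4c | L5a | L5b | L6a | L6b | L6c | L6d
  | L7a | L7b | L8a | L8b | L8c | L9.

Definition label_number (l : label) : nat :=
  match l with
  | L3 => 3
  | L4a | L4b | L4c => 4
  | L5a | L5b => 5
  | L6a | L6b | L6c | L6d => 6
  | L7a | L7b => 7
  | L8a | L8b | L8c => 8
  | L9 => 9
  end.

Definition label_points (l : label) : seq (int * int) :=
  match l with
  | L3  => [:: (1, 0); (0, 1); (-1, -1)]
  | L4a => [:: (1, 0); (0, 1); (-1, 0); (0, -1)]
  | L4b => [:: (-1, 1); (0, 1); (1, 0); (0, -1)]
  | L4c => [:: (-1, 1); (1, 1); (0, -1)]
  | L5a => [:: (-1, 1); (0, 1); (1, 0); (0, -1); (-1, 0)]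
  | L5b => [:: (-1, 1); (1, 1); (1, 0); (0, -1)]
  | L6a => [:: (-1, 1); (0, 1); (1, 0); (1, -1); (0, -1); (-1, 0)]
  | L6b => [:: (-1, 1); (1, 1); (1, 0); (0, -1); (-1, 0)]
  | L6c => [:: (-1, 1); (1, 1); (1, -1); (0, -1)]
  | L6d => [:: (-1, 1); (1, 1); (1, -2)]
  | L7a => [:: (-1, 1); (1, 1); (1, 0); (0, -1); (-1, -1)]
  | L7b => [:: (-1, 1); (1, 1); (1, -2); (0, -1)]
  | L8a => [:: (-1, 1); (1, 1); (1, -1); (-1, -1)]
  | L8b => [:: (-1, 1); (1, 1); (1, -2); (-1, 0)]
  | L8c => [:: (-1, 1); (1, 1); (1, -3)]
  | L9  => [:: (-1, 1); (-1, -2); (2, 1)]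
  end.

Definition int_point (R : realType) (p : int * int) : 'rV[R]_2 :=
  \row_j (if j == 0 then p.1 else p.2)%:~R.

Definition polygon (R : realType) (l : label) : set 'rV[R]_2 :=
  conv_hull [set` map (int_point R) (label_points l)].

Arguments polygon R l : clear implicits.

(* Main.v *)
Require Import Defs.
From HB Require Import structures.
From mathcomp Require Import all_boot all_order all_algebra.
From mathcomp Require Import all_classical all_reals all_analysis.
From mathcomp Require Import zify ring lra.

(** A reflexive polygon [P] and its dual are both lattice polygons with the
    origin in their interior. Choosing lattice coordinates, this becomes a
    statement about two finite lists of integer points, the vertices [V] of
    [P] and the vertices [U] of its dual: both lists positively span the
    plane, and [dot p u >= -1] for all [p] in [V] and [u] in [U]
    ([reflexive_data]; it needs that a polytope is the hull of its vertices,
    [hull_vertices]).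

    Let [S] be the set of integer points [y] with [dot p y >= -1] on [V], that
    is, the lattice points of the dual polygon. As [V] spans, [0] is the only
    interior point of [S]: a point [z] with [n z = i x + j y], [x] and [y] in
    [S] and [i + j < n], vanishes ([polar_interior]), while [i + j = n] only
    puts [z] in [S] ([polar_comb]). These two facts force [S] to contain, up
    to a unimodular change of coordinates, the corners of one of the polygons
    3, 4a, 4c ([polar_contains_minimal]):
    - a nonzero [x] of [S] has its opposite in the cone of two points [v], [w]
      of [S], and shrinking lattice triangles makes [v], [w] a basis;
    - then [x = - a v - b w] with [a, b >= 0]; either [a = b = 1], which is the
      polygon 3, or [S] contains a pair of opposite points;
    - for an opposite pair [x], [- x] there are [z], [z'] in [S] on either side
      of it with [z + z' = a x] and [|a| <= 2], and the values of [a] give 4a,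
      3 and 4c.

    Dually, [P] lies in the dual of 3, 4a or 4c, so its vertices come from an
    explicit list of at most nine nonzero points. A computation over all
    sublists [s] of these lists ([minimal_classified]) shows that either [s]
    lies in a closed half-plane, which is excluded since [0] is interior to
    [P], or [s] contains the corners and is contained in the lattice points of
    a unimodular image of one of the 16 polygons, whose hull it then is
    ([reflexive_classified]).

    For the polygons themselves, [hull_region] says that the hull of a list of
    points going once around the origin is cut out by the facets joining
    consecutive points. Applied to corners and to facet normals it identifies
    both each polygon and its dual, and shows that the lattice points of the
    polygon are those of an explicit finite list. An isomorphism between two
    of the polygons is an integer matrix carrying one list of lattice points
    onto the other; it is determined by two of its values, and running over
    all possible values shows that no two of the 16 lists match
    ([labels_distinct]). *)

Set Implicit Arguments.
Unset Strict Implicit.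
Unset Printing Implicit Defensive.

Import Order.TTheory GRing.Theory Num.Theory.
Import numFieldNormedType.Exports.

Local Open Scope classical_set_scope.
Local Open Scope card_scope.
Local Open Scope ring_scope.

(** * The labels as a finite list *)

Definition label_index l : nat :=
  match l with
  | L3 => 0 | L4a => 1 | L4b => 2 | L4c => 3 | L5a => 4 | L5b => 5
  | L6a => 6 | L6b => 7 | L6c => 8 | L6d => 9 | L7a => 10 | L7b => 11
  | L8a => 12 | L8b => 13 | L8c => 14 | L9 => 15
  end.

Lemma label_index_inj : injective label_index.
Proof. by case; case. Qed.

HB.instance Definition _ := Equality.copy label (inj_type label_index_inj).

Definition labels : seq label :=
  [:: L3; L4a; L4b; L4c; L5a; L5b; L6a; L6b; L6c; L6d; L7a; L7b; L8a; L8b;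
      L8c; L9].

Lemma mem_labels l : l \in labels.
Proof. by case: l. Qed.

(** No unimodular image of another of the 16 polygons lies in one of these. *)
Definition minimal_labels : seq label := [:: L3; L4a; L4c].

(** * Integer points with one interior lattice point *)

Definition dot (p q : int * int) : int := p.1 * q.1 + p.2 * q.2.
Definition cross (p q : int * int) : int := p.1 * q.2 - p.2 * q.1.
Definition comb (v w c : int * int) : int * int :=
  (c.1 * v.1 + c.2 * w.1, c.1 * v.2 + c.2 * w.2).

(** The transpose of [comb]: [dot_frame_coord] is the adjunction between the
    action of a matrix on points and on linear forms. *)
Definition frame_coord (v w p : int * int) : int * int := (dot p v, dot p w).

(** This is the way in which the fact that [0] is interior to the convex hull of
    [s] enters all arguments on integer points. *)
Definition positively_spanning (s : seq (int * int)) :=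
  forall c : int * int, (forall p, p \in s -> 0 <= dot p c) -> c = 0.

Definition polar (s : seq (int * int)) (y : int * int) :=
  all (fun p => -1 <= dot p y) s.

Lemma vec_eq (x y : int * int) : x.1 = y.1 -> x.2 = y.2 -> x = y.
Proof. by case: x; case: y => ? ? ? ? /= -> ->. Qed.

Lemma vec_eq0 (x : int * int) : x = 0 -> x.1 = 0 /\ x.2 = 0.
Proof. by move=> ->. Qed.

Lemma dotC p q : dot p q = dot q p.
Proof. by rewrite /dot mulrC [X in _ + X]mulrC. Qed.

Lemma dot_frame_coord v w p c : dot (frame_coord v w p) c = dot p (comb v w c).
Proof. rewrite /dot /frame_coord /comb /dot /=; ring. Qed.

Lemma crossNC v w : cross w v = - cross v w.
Proof. rewrite /cross; ring. Qed.

Lemma cross_neq0 v w : cross v w != 0 -> v != 0.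
Proof. by apply: contra_neq => ->; rewrite /cross /=; ring. Qed.

Lemma plucker a b c d :
  cross a b * cross c d = cross a c * cross b d + cross a d * cross c b.
Proof. rewrite /cross; ring. Qed.

(** On the open half-plane to the left of [x], the sign of [cross] is a total
    preorder, namely the order of slopes, by [plucker]. *)
Lemma furthest_in_half_plane (x : int * int) (U : seq (int * int)) :
  has (fun u => 0 < cross x u) U ->
  exists2 v, v \in U /\ 0 < cross x v &
    forall u, u \in U -> 0 < cross x u -> 0 <= cross u v.
Proof.
elim: U => [|a U IH] //= /orP H.
have [hU|nU] := boolP (has (fun u => 0 < cross x u) U); last first.
  case: H => [xa|]; last by rewrite (negPf nU).
  exists a; first by rewrite inE eqxx.
  move=> u; rewrite inE => /orP[/eqP-> _|uU xu]; first by rewrite /cross; lia.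
  by case/hasP: nU; exists u.
have [v [vU xv] vmax] := IH hU.
have [/andP[xa va]|] := boolP ((0 < cross x a) && (0 < cross v a)).
  exists a; first by rewrite inE eqxx.
  move=> u; rewrite inE => /orP[/eqP-> _|uU xu]; first by rewrite /cross; lia.
  have := plucker x v u a; have := vmax _ uU xu; nia.
rewrite negb_and -!leNgt => nxa.
exists v; first by rewrite inE vU orbT.
move=> u; rewrite inE => /orP[/eqP-> xa|]; last exact: vmax.
by move: nxa; rewrite leNgt xa /= crossNC; lia.
Qed.

Section TwoLists.
Variables V U : seq (int * int).
Hypotheses (spanV : positively_spanning V) (spanU : positively_spanning U).
Hypothesis (polarU : forall u, u \in U -> polar V u).

(** Here [z] is in the triangle with vertices [0], [x], [y]. *)
Lemma polar_comb (n i j : int) x y z :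
  0 < n -> 0 <= i -> 0 <= j -> i + j <= n ->
  n * z.1 = i * x.1 + j * y.1 -> n * z.2 = i * x.2 + j * y.2 ->
  polar V x -> polar V y -> polar V z.
Proof.
move=> n0 i0 j0 ijn z1 z2 /allP px /allP py; apply/allP => p pV.
have E : n * dot p z = i * dot p x + j * dot p y.
  by rewrite /dot !mulrDr mulrCA z1 mulrCA z2; ring.
have := px _ pV; have := py _ pV; nia.
Qed.

(** When [i + j < n], the point [z] misses the edge from [x] to [y], so all the
    integers [dot p z] are larger than [-1]. *)
Lemma polar_interior (n i j : int) x y z :
  0 <= i -> 0 <= j -> i + j < n ->
  n * z.1 = i * x.1 + j * y.1 -> n * z.2 = i * x.2 + j * y.2 ->
  polar V x -> polar V y -> z = 0.
Proof.
move=> i0 j0 ijn z1 z2 /allP px /allP py; apply: spanV => p pV.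
have E : n * dot p z = i * dot p x + j * dot p y.
  by rewrite /dot !mulrDr mulrCA z1 mulrCA z2; ring.
have := px _ pV; have := py _ pV; nia.
Qed.

(** If [v = d k] with [d > 1], then [k] would be an interior point. So the
    coordinates of [v] are coprime, and Bezout coefficients complete [v] to a
    basis. *)
Lemma polar_primitive (v : int * int) :
  v != 0 -> polar V v -> exists z, cross v z = 1.
Proof.
move=> v0 pv; have [a [b Bezout]] := Bezoutz v.1 v.2.
have [k1 E1] : exists k, v.1 = k * gcdz v.1 v.2 by apply/dvdzP/dvdz_gcdl.
have [k2 E2] : exists k, v.2 = k * gcdz v.1 v.2 by apply/dvdzP/dvdz_gcdr.
have d0 : 0 <= gcdz v.1 v.2 by [].
move: (gcdz _ _) d0 E1 E2 Bezout => d d0 E1 E2 Bezout.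
have [d1|d1] := ltP 1 d.
  have /vec_eq0 [/= k10 k20] : (k1, k2) = 0 :> (int * int)%type.
    by apply: (@polar_interior d 1 0 v v) => //=; lia.
  by case/eqP: v0; apply: vec_eq; rewrite /= ?E1 ?E2 ?k10 ?k20 mul0r.
have [dE|dE] := eqVneq d 0.
  by case/eqP: v0; apply: vec_eq; rewrite /= ?E1 ?E2 dE mulr0.
exists (- b, a); rewrite /cross /=; lia.
Qed.

(** On the line at lattice distance 1 from the line spanned by [v], the triangle
    [0], [v], [w] cuts a segment of length [(h - 1) / h], with left end [w / h];
    the denominators of its points are such that it still contains a lattice
    point. *)
Lemma lattice_triangle (v w : int * int) :
  polar V v -> polar V w -> 0 < cross v w ->
  exists z (j : int), [/\ polar V z, cross v z = 1, 0 <= j < cross v w,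
    cross v w * z.1 = w.1 + j * v.1 & cross v w * z.2 = w.2 + j * v.2].
Proof.
move=> pv pw h0; have v0 : v != 0 by apply: (@cross_neq0 v w); rewrite gt_eqF.
have [t tv] := polar_primitive v0 pv.
set h := cross v w in h0 *.
have h0' : h != 0 by rewrite gt_eqF.
pose c := cross w t; pose k := - (- c %/ h)%Z; pose j := (- c %% h)%Z.
have jE : j = h * k - c by have := divz_eq (- c) h; rewrite -/j /k; lia.
have j0 : 0 <= j by rewrite modz_ge0.
have jh : j < h by have := ltz_mod (- c) h0'; rewrite gtr0_norm.
have z1 : h * (t.1 + k * v.1) = w.1 + j * v.1.
  rewrite jE /c /h -[w.1]mulr1 -tv /cross; ring.
have z2 : h * (t.2 + k * v.2) = w.2 + j * v.2.
  rewrite jE /c /h -[w.2]mulr1 -tv /cross; ring.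
exists (t.1 + k * v.1, t.2 + k * v.2), j; split => //=.
- apply: (@polar_comb h 1 j w v) => //=; lia.
- by rewrite -tv /cross /=; ring.
- by rewrite j0.
Qed.

(** The hypotheses on [x] say that [- x] is in the cone of [v] and [w]. The
    lattice triangle on [v], [w] cuts this cone in two, and [- x] stays in one
    of the halves: one has determinant 1, the other a smaller determinant than
    the original cone. *)
Lemma unimodular_cone (x v w : int * int) :
  polar V v -> polar V w -> 0 < cross v w -> 0 <= cross w x -> 0 <= cross x v ->
  exists v' w', [/\ polar V v', polar V w', cross v' w' = 1,
    0 <= cross w' x & 0 <= cross x v'].
Proof.
have [n] := ubnP (absz (cross v w)).
elim: n v w => // n IH v w lt_n pv pw vw wx xv.
have [z [j [pz vz /andP[j0 jlt] z1 z2]]] := lattice_triangle pv pw vw.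
have [zx|zx] := leP 0 (cross z x); first by exists v, z.
have zw : cross z w = j.
  apply: (mulfI (lt0r_neq0 vw)).
  rewrite /cross mulrBr !mulrA z1 z2 /cross; ring.
have j1 : j != 0.
  apply: contraTneq zx => jE; rewrite -leNgt.
  have E : cross v w * cross z x = cross w x.
    by rewrite {2}/cross mulrBr !mulrA z1 z2 jE /cross; ring.
  by move: wx; rewrite -E pmulr_rge0.
apply: (IH z w) => //; rewrite ?zw; try lia.
by rewrite crossNC; lia.
Qed.

(** Write [x = - a v - b w]. If [a < b], then [b (- w) = x + a v] with
    [1 + a <= b], so [- w] is in the triangle [0], [x], [v]; similarly if
    [b < a]. If [a = b] then [a = 1] since [x] is primitive. *)
Lemma triangle_or_opposite (x v w : int * int) :
  polar V x -> x != 0 -> polar V v -> polar V w -> cross v w = 1 ->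
  0 <= cross w x -> 0 <= cross x v ->
  x = - v - w \/ exists y, [/\ y != 0, polar V y & polar V (- y)].
Proof.
move=> px x0 pv pw vw wx xv.
set a := cross w x in wx *; set b := cross x v in xv *.
have x1 : x.1 = - (a * v.1) - b * w.1.
  rewrite -[LHS]mulr1 -vw /a /b /cross; ring.
have x2 : x.2 = - (a * v.2) - b * w.2.
  rewrite -[LHS]mulr1 -vw /a /b /cross; ring.
have v0 : v != 0 by apply: (@cross_neq0 v w); rewrite vw.
have w0 : w != 0 by apply: (@cross_neq0 w v); rewrite crossNC vw.
clearbody a b.
have [ab|ab|ab] := ltgtP a b.
- right; exists w; split => //.
  by apply: (@polar_comb b 1 a x v) => //=; lia.
- right; exists v; split => //.
  by apply: (@polar_comb a 1 b x w) => //=; lia.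
- subst b; have [a1|a1] := ltP 1 a.
    have /vec_eq0 [/= e1 e2] : - v - w = 0.
      by apply: (@polar_interior a 1 0 x x) => //=; lia.
    by move: vw; rewrite /cross; nia.
  have [aE|aE] := eqVneq a 0.
    by case/eqP: x0; apply: vec_eq; rewrite ?x1 ?x2 aE /=; lia.
  by left; apply: vec_eq; rewrite ?x1 ?x2 (_ : a = 1) ?mul1r //; lia.
Qed.

Lemma exists_left (x : int * int) : x != 0 -> has (fun u => 0 < cross x u) U.
Proof.
move=> x0; apply: contraNT x0 => /hasPn H; apply/eqP.
suff : (x.2, - x.1) = 0 :> (int * int)%type.
  by move=> /vec_eq0 [/= e1 e2]; apply: vec_eq => /=; lia.
apply: spanU => u /H; rewrite /cross /dot /=; lia.
Qed.

(** Points [z] and [z'] at lattice distance 1 on either side of the line of [x]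
    have a sum [a x], whose half is in their hull; so [a > 2] would make [x]
    interior, and [a < -2] would make [- x] interior. *)
Lemma minimal_of_opposite (x : int * int) :
  x != 0 -> polar V x -> polar V (- x) ->
  exists v w m, [/\ cross v w ^+ 2 = 1, m \in minimal_labels
    & forall c, c \in label_points m -> polar V (comb v w c)].
Proof.
move=> x0 px pnx.
have nx0 : - x != 0 by rewrite oppr_eq0.
have /hasP [u /polarU pu xu] := exists_left x0.
have /hasP [u' /polarU pu' xu'] := exists_left nx0.
have [z [j [pz xz _ _ _]]] := lattice_triangle px pu xu.
have [z' [j' [pz' xz' _ _ _]]] := lattice_triangle pnx pu' xu'.
pose a := cross z' z.
have e1 : z.1 + z'.1 = a * x.1.
  by rewrite -[z'.1]mulr1 -[z.1]mulr1 -{1}xz' -xz /a /cross /=; ring.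
have e2 : z.2 + z'.2 = a * x.2.
  by rewrite -[z'.2]mulr1 -[z.2]mulr1 -{1}xz' -xz /a /cross /=; ring.
clearbody a.
have : a <= 2.
  rewrite leNgt; apply: contraNN x0 => a3; apply/eqP.
  by apply: (@polar_interior a 1 1 z z'); rewrite ?mul1r ?e1 ?e2.
have : -2 <= a.
  rewrite leNgt; apply: contraNN x0 => a3; rewrite -oppr_eq0; apply/eqP.
  by apply: (@polar_interior (- a) 1 1 z z'); 
    rewrite ?mul1r ?e1 ?e2 ?mulrNN //; lia.
have polar_eq y y' : y.1 = y'.1 -> y.2 = y'.2 -> polar V y' -> polar V y.
  by move=> ? ? ?; rewrite (@vec_eq y y').
have xz1 : x.1 * z.2 - x.2 * z.1 = 1 by exact: xz.
have f1 : z'.1 = a * x.1 - z.1 by rewrite -e1 addrAC subrr add0r.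
have f2 : z'.2 = a * x.2 - z.2 by rewrite -e2 addrAC subrr add0r.
move=> ma ia; have [a0|[a1|[a1|[a2|a2]]]] :
  a = 0 \/ a = 1 \/ a = -1 \/ a = 2 \/ a = -2 by lia.
- exists x, z, L4a; split => // [|c]; first by rewrite xz.
  rewrite /= !inE => /or4P[]/eqP-> /=;
    [apply: polar_eq px|apply: polar_eq pz|apply: polar_eq pnx
    |apply: polar_eq pz'];
    rewrite /= ?f1 ?f2 ?a0; lia.
- exists (- x), z', L3; split => // [|c]; first by rewrite xz'.
  rewrite /= !inE => /or3P[]/eqP-> /=;
    [apply: polar_eq pnx|apply: polar_eq pz'|apply: polar_eq pz];
    rewrite /= ?f1 ?f2 ?a1; lia.
- exists x, z, L3; split => // [|c]; first by rewrite xz.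
  rewrite /= !inE => /or3P[]/eqP-> /=;
    [apply: polar_eq px|apply: polar_eq pz|apply: polar_eq pz'];
    rewrite /= ?f1 ?f2 ?a1; lia.
- exists (z - x), x, L4c; split => // [|c].
    rewrite (_ : cross _ _ = -1) // /cross /=; lia.
  rewrite /= !inE => /or3P[]/eqP-> /=;
    [apply: polar_eq pz'|apply: polar_eq pz|apply: polar_eq pnx];
    rewrite /= ?f1 ?f2 ?a2; lia.
- exists (z + x), (- x), L4c; split => // [|c].
    rewrite (_ : cross _ _ = 1) // /cross /=; lia.
  rewrite /= !inE => /or3P[]/eqP-> /=;
    [apply: polar_eq pz'|apply: polar_eq pz|apply: polar_eq px];
    rewrite /= ?f1 ?f2 ?a2; lia.
Qed.

(** The point [v] of [U] chosen left of [x] is the closest one to the direction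
    of [- x]; some [w] in [U] then makes [v], [w] a cone containing [- x]. *)
Lemma polar_contains_minimal :
  exists v w m, [/\ cross v w ^+ 2 = 1, m \in minimal_labels
    & forall c, c \in label_points m -> polar V (comb v w c)].
Proof.
have : has (fun u => u != 0) U.
  apply/negPn/negP => /hasPn U0.
  suff /vec_eq0 [] : (1, 0) = 0 :> (int * int)%type by [].
  by apply: spanU => u /U0; rewrite negbK => /eqP->.
case/hasP => x xU x0; have px := polarU xU.
have [v [vU xv] vmax] := furthest_in_half_plane (exists_left x0).
(* Otherwise all of [U] would be on one side of the line spanned by [v]. *)
have : has (fun w => (0 < cross v w) && (0 <= cross w x)) U.
  apply/negPn/negP => /hasPn H.
  have /vec_eq0 [/= e1 e2] : (v.2, - v.1) = 0 :> (int * int)%type.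
    apply: spanU => u uU; suff : cross v u <= 0 by rewrite /cross /dot /=; lia.
    move: (H _ uU); rewrite negb_and -leNgt -ltNge => /orP[//|ux].
    have := vmax _ uU; rewrite !(crossNC u); lia.
  by move: xv; rewrite /cross; nia.
case/hasP => w wU /andP[vw wx].
have [v' [w' [pv' pw' vw' wx' xv']]] :=
  unimodular_cone (polarU vU) (polarU wU) vw wx (ltW xv).
have [xE|[y [y0 py pny]]] := triangle_or_opposite px x0 pv' pw' vw' wx' xv'.
  exists v', w', L3; split => // [|c]; first by rewrite vw'.
  rewrite /= !inE => /or3P[]/eqP-> /=; last rewrite (_ : comb _ _ _ = x) //.
  - by rewrite (_ : comb _ _ _ = v') //; apply: vec_eq => /=; lia.
  - by rewrite (_ : comb _ _ _ = w') //; apply: vec_eq => /=; lia.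
  - by rewrite xE; apply: vec_eq => /=; lia.
exact: minimal_of_opposite py pny.
Qed.

End TwoLists.

(** * The finite computations *)

Definition square (k : nat) : seq (int * int) :=
  [seq (i%:Z - k%:Z, j%:Z - k%:Z) | i <- iota 0 k.*2.+1, j <- iota 0 k.*2.+1].

Definition ccw (s : seq (int * int)) :=
  if 0 < cross s`_0 s`_1 then s else rev s.

(** The solution [u] of [dot v u = dot w u = -1], by Cramer's rule. *)
Definition normal (v w : int * int) : int * int :=
  ((v.2 - w.2) %/ cross v w, (w.1 - v.1) %/ cross v w)%Z.

Definition corners l := ccw (label_points l).

(** The vertices of the dual polygon, in the order of the edges to which they
    are normal. *)
Definition facets l :=
  let s := corners l in pairmap normal (last 0 s) s.

(** Two points in positive position that span an edge of the polygon cut out by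
    the normals in [t]. *)
Definition edge (t : seq (int * int)) v w :=
  (0 < cross v w) && has (fun u => (dot v u == -1) && (dot w u == -1)) t.

(** All 16 polygons fit in [square 3]. *)
Definition lattice_points l := [seq p <- square 3 | polar (facets l) p].

(** Corners and facets play symmetric parts in the first two clauses, which give
    the polygon and its dual through [hull_region]. The last clause provides a
    lattice basis consisting of lattice points of the polygon. *)
Definition label_ok l :=
  let s := corners l in let t := facets l in
  [&& cycle (edge t) s, cycle (edge s) t, all (polar t) s,
      all [in square 3] s,
      size [seq p <- lattice_points l | p != 0] == label_number l,
      all (fun p => (p == 0) || has (fun u => dot p u == -1) t)
        (lattice_points l)
    & ((0, 1) \in lattice_points l) &&
      (((1, 0) \in lattice_points l) || ((1, 1) \in lattice_points l))].

Lemma labels_ok : all label_ok labels.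
Proof. by vm_compute. Qed.

(** Whether some linear map carries the lattice points of [l] onto those of
    [l']. Such a map is known from the images [r2] of [(0, 1)] and [r] of a
    lattice point [e], equal to [(1, 0)] or [(1, 1)]; [r2] and [r] are lattice
    points of [l']. *)
Definition same_lattice_points l l' :=
  let s := lattice_points l in let s' := lattice_points l' in
  has (fun e : int * int => (e \in s) && has (fun r2 => has (fun r =>
    let r1 := (r.1 - e.2 * r2.1, r.2 - e.2 * r2.2) in
    let t := map (comb r1 r2) s in
    all [in s'] t && all [in t] s') s') s') [:: (1, 0); (1, 1)].

Lemma labels_distinct :
  all (fun l => all (fun l' => same_lattice_points l l' ==> (l == l')) labels)
    labels.
Proof. by vm_compute. Qed.

(** The nonzero lattice points of the dual of the polygon [m]. *)
Definition candidates m :=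
  [seq p <- square 3 | (p != 0) && polar (label_points m) p].

(** Entries up to 2 already give enough matrices for [minimal_classified]. *)
Definition frames : seq ((int * int) * (int * int)) :=
  [seq f <- [seq (v, w) | v <- square 2, w <- square 2]
     | (cross f.1 f.2 == 1) || (cross f.1 f.2 == -1)].

Fixpoint bitseqs n : seq bitseq :=
  if n is n'.+1 then [seq b :: m | b <- [:: true; false], m <- bitseqs n']
  else [:: [::]].

(** Sublists of a fixed list [L] are represented by bit masks over [L]: this
    turns all the inclusion tests of the enumeration into Boolean operations,
    and makes duplicates easy to remove. *)
Definition indicator (L s : seq (int * int)) : bitseq := [seq p \in s | p <- L].

Definition half_planes (L : seq (int * int)) : seq bitseq :=
  undup [seq [seq 0 <= dot p c | p <- L] | c <- square 2 & c != 0].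

(** For each unimodular image of one of the 16 polygons with corners in [L], the
    masks of its corners and of its lattice points. *)
Definition placements (L : seq (int * int)) : seq (bitseq * bitseq) :=
  undup (flatten [seq
    let c := corners l in let pts := lattice_points l in
    [seq (indicator L (map (comb f.1 f.2) c),
          indicator L (map (comb f.1 f.2) pts))
       | f <- frames & all (fun p => comb f.1 f.2 p \in L) c]
    | l <- labels]).

Definition mask_le (m m' : bitseq) := all2 implb m m'.

(** Every sublist of [L] either lies in a half-plane or is squeezed between the
    corners and the lattice points of one of the polygons. *)
Definition classified_over (L : seq (int * int)) :=
  let hs := half_planes L in let sq := placements L in
  all (fun m => has (mask_le m) hs ||
                has (fun x => mask_le x.1 m && mask_le m x.2) sq)
    (bitseqs (size L)).

Lemma minimal_classified : all classified_over (map candidates minimal_labels).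
Proof. by vm_compute. Qed.

(** * Convex hulls *)

Section ConvexHull.
Variables (R : realType) (V : lmodType R).
Implicit Types (A C : set V) (s : seq V) (x y : V).

Definition mix_closed C :=
  forall x y t, C x -> C y -> 0 <= t <= 1 -> C (t *: x + (1 - t) *: y).

Lemma convex_setP C : convex_set (C : set (convex_lmodType V)) <-> mix_closed C.
Proof.
split => [cC x y t Cx Cy /andP[t0 t1]|cC x y t].
  by have := cC x y (Itv01 t0 t1) (mem_set Cx) (mem_set Cy) => /set_mem.
move=> /set_mem Cx /set_mem Cy; apply/mem_set.
by apply: cC => //; rewrite ge0 le1.
Qed.

Lemma hull_sub A C : mix_closed C -> A `<=` C -> conv_hull A `<=` C.
Proof. by move=> /convex_setP; exact: smallest_sub. Qed.

Lemma hull_gen A : A `<=` conv_hull A.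
Proof. exact: sub_gen_smallest. Qed.

Lemma hull_mix A : mix_closed (conv_hull A).
Proof.
move=> x y t hx hy t01 C [cC AC].
by move/convex_setP: (cC); apply => //; [apply: hx|apply: hy].
Qed.

Lemma hull_mono A C : A `<=` C -> conv_hull A `<=` conv_hull C.
Proof. by move=> AC; apply: hull_sub (@hull_mix C) _ => x /AC /hull_gen. Qed.

(** Unnormalised convex combinations: this form avoids dividing by weights that
    may vanish. *)
Lemma mix_scaled C (a b : R) x y : mix_closed C -> 0 <= a -> 0 <= b ->
  C x -> C y -> exists2 z, C z & a *: x + b *: y = (a + b) *: z.
Proof.
move=> cC a0 b0 Cx Cy; have [ab|ab] := eqVneq (a + b) 0.
  have -> : a = 0 by lra.
  have -> : b = 0 by lra.
  by exists x => //; rewrite addr0 !scale0r addr0.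
have ab0 : 0 < a + b by rewrite lt_neqAle eq_sym ab addr_ge0.
exists ((a / (a + b)) *: x + (1 - a / (a + b)) *: y).
  apply: cC => //; rewrite divr_ge0 ?addr_ge0 //= ler_pdivrMr // mul1r.
  by rewrite lerDl.
rewrite scalerDr !scalerA mulrBr mulrCA divff // !mulr1.
by congr (_ + _ *: _); ring.
Qed.

Lemma mix3 C (a b c : R) x y z : mix_closed C -> 0 <= a -> 0 <= b -> 0 <= c ->
  a + b + c = 1 -> C x -> C y -> C z -> C (a *: x + b *: y + c *: z).
Proof.
move=> cC a0 b0 c0 abc Cx Cy Cz.
have [w Cw ->] := mix_scaled cC a0 b0 Cx Cy.
by rewrite (_ : c = 1 - (a + b)); [apply: cC => //; lra|lra].
Qed.

(** If [v] is an extreme point, then removing it from the hull leaves a convex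
    set. *)
Lemma vertex_gen A v : vertex (conv_hull A) v -> A v.
Proof.
move=> [hv ext]; apply: contrapT => nAv.
suff H : conv_hull A `<=` conv_hull A `\ v by case: (H _ hv) => _; apply.
apply: hull_sub => [x y t [hx xv] [hy yv] t01|x Ax]; last first.
  by split; [exact: hull_gen|move=> xv; apply: nAv; rewrite -xv].
split; first exact: hull_mix.
move=> /= E; have [t0|t0] := eqVneq t 0.
  by apply: yv; rewrite -E t0 scale0r add0r subr0 scale1r.
have [t1|t1] := eqVneq t 1.
  by apply: xv; rewrite -E t1 subrr scale0r addr0 scale1r.
have t01' : 0 < t < 1.
  by case/andP: t01 => ? ?; rewrite !lt_neqAle eq_sym t0 t1; apply/andP.
by apply: xv; have [-> _] := ext x y t hx hy t01' (esym E).
Qed.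

(** Induction on the number of generators: a generator [v] that is not a vertex
    is in the hull of the other ones. For [v] is a proper mixture of two points
    of the hull, each of which is a mixture of [v] and of a point in the hull of
    the others; collecting the terms in [v] gives [(1 - g) v = (1 - g) z], and
    [g = 1] would force both points to be [v]. *)
Lemma hull_vertices s :
  exists2 s' : seq V, conv_hull [set` s] = conv_hull [set` s'] &
  forall v, v \in s' -> vertex (conv_hull [set` s]) v.
Proof.
have [n] := ubnP (size s); elim: n s => // n IH s lt_n.
have [all_v|] := pselect (forall v, v \in s -> vertex (conv_hull [set` s]) v).
  by exists s.
move=> /existsNP [v] /not_implyP [vs nv].
pose s1 := [seq u <- s | u != v].
suff vs1 : conv_hull [set` s1] v.
  have E : conv_hull [set` s] = conv_hull [set` s1].
    apply/seteqP; split; last first.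
      by apply: hull_mono => u /=; rewrite mem_filter => /andP[].
    apply: hull_sub (@hull_mix _) _ => u /= us.
    have [->//|uv] := eqVneq u v.
    by apply: hull_gen; rewrite /= mem_filter uv.
  rewrite E; apply: IH; move: lt_n; rewrite ltnS; apply: leq_trans.
  by rewrite size_filter -(count_predC (pred1 v) s) addnC -addn1 leq_add2l
    -has_count has_pred1.
apply: contrapT => nvs1; apply: nv; split; first exact: hull_gen.
move=> x y t hx hy /andP[t0 t1] vE.
have [s1E|[w0 w0s1]] : s1 = [::] \/ exists w0, w0 \in s1.
    by case: (s1) => [|w0 ?]; [left|right; exists w0; rewrite mem_head].
  have hv : conv_hull [set` s] `<=` [set v].
    apply: hull_sub => [_ _ r -> -> _ /=|u us /=].
      by rewrite -scalerDl addrC subrK scale1r.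
    apply/eqP/negPn/negP => uv.
    by have : u \in s1; [rewrite mem_filter uv|rewrite s1E].
  by split; exact: hv.
pose D := [set z | exists a w,
  [/\ 0 <= a <= 1, conv_hull [set` s1] w & z = a *: v + (1 - a) *: w]].
have hD : conv_hull [set` s] `<=` D.
  apply: hull_sub => [_ _ r [a [w [a01 hw ->]]] [b [w' [b01 hw' ->]]] r01|u us].
    have [] := @mix_scaled _ (r * (1 - a)) ((1 - r) * (1 - b)) w w'
      (@hull_mix [set` s1]) _ _ hw hw'; [nra|nra|].
    move=> z hz zE; exists (r * a + (1 - r) * b), z; split => //; first nra.
    rewrite !scalerDr !scalerA addrACA zE -scalerDl.
    by congr (_ + _ *: _); ring.
  have [->|uv] := eqVneq u v.
    exists 1, w0; split; [lra|exact: hull_gen|].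
    by rewrite subrr scale0r addr0 scale1r.
  exists 0, u; split; [lra| |by rewrite subr0 scale0r add0r scale1r].
  by apply: hull_gen; rewrite /= mem_filter uv.
have [a [w [/andP[a0 a1] hw xE]]] := hD _ hx.
have [b [w' [/andP[b0 b1] hw' yE]]] := hD _ hy.
have [] := @mix_scaled _ (t * (1 - a)) ((1 - t) * (1 - b)) w w'
  (@hull_mix [set` s1]) _ _ hw hw'; [nra|nra|].
move=> z hz zE.
have vE' : (1 - (t * a + (1 - t) * b)) *: v =
           (1 - (t * a + (1 - t) * b)) *: z.
  rewrite scalerBl scale1r {1}vE xE yE !scalerDr !scalerA addrACA zE -scalerDl.
  by rewrite addrAC subrr add0r; congr (_ *: _); ring.
have [g1|g1] := eqVneq (1 - (t * a + (1 - t) * b)) 0; last first.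
  by case: nvs1; rewrite (scalerI g1 vE').
have aE : a = 1 by nra.
have bE : b = 1 by nra.
by rewrite xE yE aE bE subrr !scale0r !addr0 !scale1r.
Qed.
End ConvexHull.

Lemma hull_image (R : realType) (V W : lmodType R) (f : {linear V -> W}) A :
  conv_hull (f @` A) = f @` conv_hull A.
Proof.
apply/seteqP; split.
  apply: hull_sub => [_ _ t [x hx <-] [y hy <-] t01|_ [x Ax <-]]; last first.
    by exists x => //; exact: hull_gen.
  by exists (t *: x + (1 - t) *: y); [exact: hull_mix|rewrite linearD !linearZ].
move=> _ [x hx <-]; suff: conv_hull A `<=` f @^-1` conv_hull (f @` A) by apply.
apply: hull_sub => [y z t hy hz t01|y Ay].
  by rewrite /preimage /= linearD !linearZ; exact: hull_mix.
by apply: hull_gen; exists y.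
Qed.

(** * Polygons as intersections of half-planes *)

Section Plane.
Variable R : realType.
Implicit Types (x y : 'rV[R]_2) (s t : seq (int * int)).

Lemma row2_eq x y : x 0 0 = y 0 0 -> x 0 1 = y 0 1 -> x = y.
Proof.
move=> e0 e1; apply/rowP => j; case: j => -[|[|//]] jlt.
  by rewrite (_ : Ordinal _ = 0) //; exact: val_inj.
by rewrite (_ : Ordinal _ = 1) //; exact: val_inj.
Qed.

Definition lin_form (u : int * int) x : R := u.1%:~R * x 0 0 + u.2%:~R * x 0 1.

Lemma lin_form_mix u a b x y :
  lin_form u (a *: x + b *: y) = a * lin_form u x + b * lin_form u y.
Proof. by rewrite /lin_form !mxE; ring. Qed.

Lemma lin_form_int_point u p : lin_form u (int_point R p) = (dot p u)%:~R.
Proof.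
by rewrite /lin_form !mxE /= /dot rmorphD !rmorphM /= mulrC [X in _ + X]mulrC.
Qed.

Definition region t :=
  [set x : 'rV[R]_2 | forall u, u \in t -> -1 <= lin_form u x].

Lemma mix_closed_region t : mix_closed (region t).
Proof.
move=> x y r hx hy r01 u ut; rewrite lin_form_mix.
have := hx _ ut; have := hy _ ut; nra.
Qed.

(** The determinant of the integer point [p] and the real point [x]. *)
Definition side x (p : int * int) : R := p.1%:~R * x 0 1 - p.2%:~R * x 0 0.

Lemma sideN x p : side (- x) p = - side x p.
Proof. by rewrite /side !mxE; ring. Qed.

Lemma side_plucker x a b c :
  (cross a c)%:~R * side x b =
  (cross a b)%:~R * side x c + (cross b c)%:~R * side x a.
Proof. by rewrite /cross /side !rmorphB !rmorphM /=; ring. Qed.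

Lemma cross_trans x :
  {in [pred p | 0 < side x p] & &, transitive (fun a b => 0 < cross a b)}.
Proof.
move=> b a c; rewrite !inE => sb sa sc ab bc.
have := side_plucker x a b c.
rewrite -(ltr0z R) in ab; rewrite -(ltr0z R) in bc; rewrite -(ltr0z R) => E.
by rewrite -(pmulr_lgt0 _ sb) E addr_gt0 // mulr_gt0.
Qed.

(** In an open half-plane the relation [0 < cross a b] is transitive, hence has
    no cycles. *)
Lemma no_cycle_in_half_plane t x v q :
  cycle (edge t) (v :: q) -> ~~ all (fun p => 0 < side x p) (v :: q).
Proof.
move=> cyc; apply/negP => pos.
have pos' : all [in [pred p | 0 < side x p]] (v :: rcons q v).
  rewrite /= all_rcons; case/andP: pos => pv /allP pq; rewrite !inE pv /=.
  exact/allP.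
have : path (fun a b => 0 < cross a b) v (rcons q v).
  by apply: sub_path cyc => a b /andP[].
move/(order_path_min_in (@cross_trans x) pos').
by rewrite all_rcons /cross mulrC subrr ltxx.
Qed.

Lemma path_turn t x v q : path (edge t) v q -> 0 <= side x v ->
  (exists a b, [/\ a \in v :: q, b \in v :: q, edge t a b, 0 <= side x a
     & side x b <= 0])
  \/ all (fun p => 0 < side x p) q.
Proof.
elim: q v => [|w q IH] v /=; first by right.
move=> /andP[vw wq] sv; have [sw|sw] := leP (side x w) 0.
  by left; exists v, w; rewrite !inE !eqxx orbT.
have [[a [b [aq bq ab sa sb]]]|->] := IH w wq (ltW sw); last by right.
by left; exists a, b; split => //; rewrite inE ?aq ?bq orbT.
Qed.

(** Going around the list, the sign of [side x] cannot be constant, so at some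
    edge it turns from nonnegative to nonpositive: that is the cone of [x]. *)
Lemma cone_of_cycle t s x : cycle (edge t) s -> s != [::] ->
  exists a b, [/\ a \in s, b \in s, edge t a b, 0 <= side x a & side x b <= 0].
Proof.
move=> cyc s0.
have [/hasP[v vs sv]|/hasPn H] := boolP (has (fun p => 0 <= side x p) s).
  have [i q E] := rot_to vs.
  have cyc' : cycle (edge t) (v :: q) by rewrite -E rot_cycle.
  have mem_s a : a \in v :: rcons q v -> a \in s.
    by rewrite -(mem_rot i s) E !inE mem_rcons inE orbA orbb.
  have [[a [b [aq bq ab sa sb]]]|H] := path_turn cyc' sv.
    by exists a, b; split => //; exact: mem_s.
  case/negP: (no_cycle_in_half_plane x cyc').
  by move: H; rewrite all_rcons.
case: s cyc s0 H => // v q cyc _ H.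
case/negP: (no_cycle_in_half_plane (- x) cyc).
by apply/allP => p /H; rewrite sideN oppr_gt0 -ltNge.
Qed.

Lemma cone_coordinates x a b :
  (cross a b)%:~R *: x =
  (- side x b) *: int_point R a + side x a *: int_point R b.
Proof.
by apply: row2_eq; rewrite !mxE /= /side /cross rmorphB !rmorphM /=; ring.
Qed.

(** A point [x] of the region is in the cone of some edge [a], [b], and the
    normal of that edge bounds the sum of its two coordinates by 1; so [x] is in
    the triangle [0], [a], [b]. To see that [0] is in the hull, apply the
    decomposition in cones to the opposite of a point of [s]. *)
Lemma hull_region s t : cycle (edge t) s -> s != [::] -> all (polar t) s ->
  conv_hull [set` map (int_point R) s] = region t.
Proof.
move=> cyc s0 /allP st; set P := conv_hull _.
have genP p : p \in s -> P (int_point R p).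
  by move=> ps; apply: hull_gen; rewrite /= map_f.
have cone x : exists a b (c d : R),
  [/\ a \in s, b \in s, edge t a b, 0 <= c & 0 <= d /\
    x = c *: int_point R a + d *: int_point R b].
  have [a [b [aS bS ab sa sb]]] := cone_of_cycle x cyc s0.
  have ab0 : 0 < (cross a b)%:~R :> R by rewrite ltr0z; case/andP: ab.
  exists a, b, (- side x b / (cross a b)%:~R), (side x a / (cross a b)%:~R).
  split => //; first by rewrite divr_ge0 ?oppr_ge0 // ltW.
  split; first by rewrite divr_ge0 // ltW.
  apply: (scalerI (lt0r_neq0 ab0)).
  rewrite cone_coordinates scalerDr !scalerA ![_ * (_ / _)]mulrC.
  by rewrite !divfK ?lt0r_neq0.
have P0 : P 0.
  have [v vs] : exists v, v \in s.
    by case: (s) s0 => // v ? _; exists v; rewrite mem_head.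
  have [a [b [c [d [aS bS _ c0 [d0 E]]]]]] := cone (- int_point R v).
  have e0 : 0 < 1 + c + d by lra.
  suff <- : (1 + c + d)^-1 *: int_point R v +
    (c / (1 + c + d)) *: int_point R a + (d / (1 + c + d)) *: int_point R b = 0.
    apply: (@mix3 _ _ P); rewrite ?divr_ge0 ?invr_ge0 ?(ltW e0) //;
      try exact: genP.
    - exact: hull_mix.
    - by field; lra.
  apply: (scalerI (lt0r_neq0 e0)); rewrite scaler0 !scalerDr !scalerA.
  rewrite ![_ * (_ / _)]mulrC !divfK ?lt0r_neq0 // divff ?lt0r_neq0 //.
  by rewrite scale1r -addrA -E subrr.
apply/seteqP; split.
  apply: hull_sub; first exact: mix_closed_region.
  move=> _ /mapP[p ps ->] u ut; rewrite lin_form_int_point.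
  by rewrite -(mulrN1z 1) ler_int dotC; exact: (allP (st _ ps)).
move=> x hx; have [a [b [c [d [aS bS ab c0 [d0 E]]]]]] := cone x.
have /andP[_ /hasP[u ut /andP[/eqP au /eqP bu]]] := ab.
have := hx _ ut; rewrite E lin_form_mix !lin_form_int_point au bu => le1.
rewrite -[_ + _]addr0 -(scaler0 _ (1 - c - d)).
apply: (@mix3 _ _ P) => //; try exact: genP; try exact: hull_mix; lra.
Qed.

End Plane.

(** * Topology *)

Section Topology.
Variable R : realType.
Implicit Types (x y : 'rV[R]_2) (s t : seq (int * int)) (P : set 'rV[R]_2).

Lemma lin_form_continuous u : continuous (@lin_form R u).
Proof.
move=> x; have c i : (fun y : 'rV[R]_2 => y 0 i) @ x --> x 0 i.
  exact: coord_continuous.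
have c0 := @cvgMl_tmp _ _ _ _ _ u.1%:~R _ (c 0).
have c1 := @cvgMl_tmp _ _ _ _ _ u.2%:~R _ (c 1).
by have := cvgD (c0 _) (c1 _); exact.
Qed.

Lemma region_closed t : closed (region t : set 'rV[R]_2).
Proof.
rewrite (_ : region t =
  \bigcap_(u in [set` t]) (lin_form u @^-1` [set z | -1 <= z])).
  apply: closed_bigI => u _; apply: closed_comp; last exact: closed_ge.
  by move=> x _; exact: lin_form_continuous.
by apply/seteqP; split.
Qed.

Lemma region_nbhs0 t : (region t)° (0 : 'rV[R]_2).
Proof.
rewrite /interior /=; elim: t => [|u t IH].
  by apply: filterS filterT => x _ u.
have F : \forall x \near (0 : 'rV[R]_2), -1 < lin_form u x.
  apply: (@lin_form_continuous u 0 [set z | -1 < z]).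
  by rewrite /lin_form !mxE !mulr0 addr0; apply: lt_nbhsr; rewrite ltrN10.
apply: filterS (filterI F IH) => x [xu xt] v; rewrite inE => /orP[/eqP->|vt].
  exact: ltW.
exact: xt.
Qed.

Lemma nbhs_ray P x y : P° x -> exists2 d : R, 0 < d & P (x + d *: y).
Proof.
move=> Px; have C : (fun d : R => x + d *: y) @ (0 : R) --> x.
  rewrite -[X in _ --> X]addr0 -(scale0r y).
  by apply: cvgD; [exact: cvg_cst|apply: cvgZr_tmp; exact: cvg_id].
have /nbhs_ballP [e /= e0 H] := C _ Px.
exists (e / 2); first by rewrite divr_gt0.
by apply: H; rewrite /ball /= sub0r normrN gtr0_norm ?divr_gt0 //; lra.
Qed.

End Topology.

(** * Isomorphisms as matrices *)

Section Isomorphisms.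
Variable R : realType.
Implicit Types (A B : 'M[R]_2) (M P : set 'rV[R]_2).

Lemma mx_isomorphic A M P : A \in unitmx ->
  isomorphic (M, P) (mulmxr A @` M, mulmxr A @` P).
Proof.
move=> uA; exists (mulmxr A); split => //; split => //=.
by move=> x y _ _ /= /(congr1 (mulmxr (invmx A))) /=; rewrite !mulmxK.
Qed.

(** The map is only known to be injective on the lattice, which an irrational
    projection of the plane onto a line is as well. What makes it invertible is
    that its image contains a basis of the target lattice. *)
Lemma isomorphic_mx M P M' P' : is_lattice M -> is_lattice M' ->
  isomorphic (M, P) (M', P') ->
  exists2 A, A \in unitmx & M' = mulmxr A @` M /\ P' = mulmxr A @` P.
Proof.
move=> [B uB ME] [B' uB' M'E] [f [[/= ff fi fs] fP]].
pose A := lin1_mx f.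
have fA : f = mulmxr A :> (_ -> _) by apply/funext => x; rewrite /= mul_rV_lin1.
have M'f : M' = f @` M.
  by apply/seteqP; split => [y /fs [x Mx <-]|_ [x Mx <-]]; [exists x|exact: ff].
exists A; last by rewrite -fA.
have rowB' i : exists z : 'rV[int]_2, map_mx intr z *m B *m A = row i B'.
  have : M' (row i B').
    by rewrite M'E; exists (delta_mx 0 i) => //; rewrite map_delta_mx -rowE.
  move/fs => [x Mx E]; move: Mx; rewrite ME => -[z _ zE]; exists z.
  by rewrite zE -E /A mul_rV_lin1.
have [Z ZE] := fin_all_exists rowB'.
have : B' = (\matrix_i map_mx intr (Z i)) *m B *m A.
  by apply/row_matrixP => i; rewrite -ZE !row_mul rowK.
by move=> E; move: uB'; rewrite E unitmx_mul => /andP[].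
Qed.

Lemma isomorphic_refl (MP : lattice_pair R) : isomorphic MP MP.
Proof.
case: MP => M P; have := @mx_isomorphic 1%:M M P (unitmx1 _ _).
have E (S : set 'rV[R]_2) : mulmxr 1%:M @` S = S.
  apply/seteqP; split => [_ [x Sx <-] /=|x Sx]; [|exists x => //=];
    by rewrite mulmx1.
by rewrite !E.
Qed.

Lemma isomorphic_sym (MP MP' : lattice_pair R) :
  is_lattice MP.1 -> is_lattice MP'.1 -> isomorphic MP MP' -> isomorphic MP' MP.
Proof.
case: MP MP' => M P [M' P'] /= lM lM' /(isomorphic_mx lM lM') [A uA [-> ->]].
have := @mx_isomorphic (invmx A) (mulmxr A @` M) (mulmxr A @` P).
rewrite unitmx_inv => /(_ uA); rewrite !image_comp.
have E (S : set 'rV[R]_2) : (mulmxr (invmx A) \o mulmxr A) @` S = S.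
  apply/seteqP; split => [_ [x Sx <-] /=|x Sx]; [|exists x => //=];
    by rewrite mulmxK.
by rewrite !E.
Qed.

Lemma isomorphic_trans (MP1 MP2 MP3 : lattice_pair R) :
  isomorphic MP1 MP2 -> isomorphic MP2 MP3 -> isomorphic MP1 MP3.
Proof.
move=> [f [fb fP]] [g [gb gP]]; exists (g \o f); split.
  exact: set_bij_comp fb gb.
by rewrite -gP -fP image_comp.
Qed.

End Isomorphisms.

(** * Integer points and unimodular matrices *)

Section IntegerPoints.
Variable R : realType.
Implicit Types (x y : 'rV[R]_2) (s t : seq (int * int)).

Lemma sum_ord2 (V : nmodType) (F : 'I_2 -> V) : \sum_i F i = F 0 + F 1.
Proof.
by rewrite !big_ord_recl big_ord0 addr0; congr (_ + F _); exact: val_inj.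
Qed.

Lemma pairing_int_point p (y : 'cV[R]_2) :
  pairing (int_point R p) y = lin_form p y^T.
Proof. by rewrite /pairing mxE sum_ord2 /lin_form !mxE. Qed.

Lemma int_point_inj : injective (int_point R).
Proof.
move=> p q /rowP E; apply: vec_eq; apply/eqP; rewrite -(eqr_int R); apply/eqP.
  by have := E 0; rewrite !mxE.
by have := E 1; rewrite !mxE.
Qed.

Lemma int_point0 : int_point R 0 = 0.
Proof. by apply/rowP => j; rewrite !mxE /=; case: ifP. Qed.

Lemma map_mx_int_point (z : 'rV[int]_2) :
  map_mx intr z = int_point R (z 0 0, z 0 1).
Proof. by apply: row2_eq; rewrite !mxE. Qed.

Lemma int_point_map_mx (p : int * int) :
  int_point R p = map_mx intr (\row_j (if j == 0 :> 'I_2 then p.1 else p.2)).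
Proof. by apply/rowP => j; rewrite !mxE. Qed.

Lemma integer_spanE (B : 'M[R]_2) :
  integer_span B = [set int_point R p *m B | p in [set: int * int]].
Proof.
apply/seteqP; split => [_ [z _ <-]|_ [p _ <-]].
  by exists (z 0 0, z 0 1) => //; rewrite map_mx_int_point.
by rewrite int_point_map_mx; eexists.
Qed.

Lemma Z2E : Z2 R = range (int_point R).
Proof.
rewrite /Z2 integer_spanE; apply/seteqP.
by split => [_ [p _ <-]|_ [p _ <-]]; exists p => //; rewrite mulmx1.
Qed.

Lemma is_lattice_Z2 : is_lattice (Z2 R).
Proof. by exists 1%:M; rewrite ?unitmx1. Qed.

Definition frame_mx (r1 r2 : int * int) : 'M[R]_2 :=
  \matrix_i int_point R (if i == 0 then r1 else r2).

Lemma mul_frame_mx p r1 r2 :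
  int_point R p *m frame_mx r1 r2 = int_point R (comb r1 r2 p).
Proof.
rewrite mulmx_sum_row sum_ord2 !rowK /=.
by apply: row2_eq; rewrite !mxE /= rmorphD !rmorphM.
Qed.

(** The inverse is the adjugate matrix times the determinant, which is its own
    inverse. *)
Lemma frame_mx_inverse r1 r2 : cross r1 r2 ^+ 2 = 1 ->
  exists r1' r2', frame_mx r1 r2 *m frame_mx r1' r2' = 1%:M.
Proof.
set e := cross r1 r2 => e2.
exists (e * r2.2, - e * r1.2), (- e * r2.1, e * r1.1).
apply/row_matrixP => i; rewrite row_mul rowK mul_frame_mx.
have -> : row i 1%:M = int_point R (if i == 0 then (1, 0) else (0, 1)).
  apply/rowP => j; rewrite !mxE.
  by case: i => -[|[|//]] ilt; case: j => -[|[|//]] jlt.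
by case: ifP => _; congr int_point; apply: vec_eq => /=;
  rewrite -1?e2 /e /cross; ring.
Qed.

Lemma image_map_seq (T U : eqType) (f : T -> U) (s : seq T) :
  f @` [set` s] = [set` map f s].
Proof.
apply/seteqP; split => [_ [x xs <-]|_ /mapP [x xs ->]]; last by exists x.
by rewrite /= map_f.
Qed.

Lemma isomorphic_frame r1 r2 s : cross r1 r2 ^+ 2 = 1 ->
  isomorphic (Z2 R, conv_hull [set` map (int_point R) s])
             (Z2 R, conv_hull [set` map (int_point R) (map (comb r1 r2) s)]).
Proof.
move=> /frame_mx_inverse [r1' [r2' E]].
have [uF _] := mulmx1_unit E.
have := mx_isomorphic (Z2 R) (conv_hull [set` map (int_point R) s]) uF.
rewrite -hull_image image_map_seq.
have -> : map (mulmxr (frame_mx r1 r2)) (map (int_point R) s) =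
          map (int_point R) (map (comb r1 r2) s).
  by rewrite -!map_comp; apply: eq_map => p /=; rewrite mul_frame_mx.
suff -> : mulmxr (frame_mx r1 r2) @` Z2 R = Z2 R by [].
rewrite Z2E; apply/seteqP; split => [_ [_ [p _ <-] <-]|_ [p _ <-]].
  by exists (comb r1 r2 p) => //=; rewrite mul_frame_mx.
exists (int_point R (comb r1' r2' p)); first by exists (comb r1' r2' p).
by rewrite /= -mul_frame_mx -mulmxA (mulmx1C E) mulmx1.
Qed.

End IntegerPoints.

(** * The 16 polygons *)

Section Labels.
Variable R : realType.

Lemma mem_square k (p : int * int) :
  (p \in square k) =
  [&& - k%:Z <= p.1, p.1 <= k%:Z, - k%:Z <= p.2 & p.2 <= k%:Z].
Proof.
apply/allpairsP/and4P => [[[i j] []]|[h1 h2 h3 h4]].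
  by rewrite !mem_iota => /= hi hj ->; split => /=; lia.
exists (absz (p.1 + k%:Z), absz (p.2 + k%:Z)).
rewrite !mem_iota; split => /=; try lia.
by apply: vec_eq => /=; lia.
Qed.

Lemma label_okP l : label_ok l.
Proof.
exact: (allP labels_ok _ (mem_labels l)).
Qed.

Lemma mem_corners l p : (p \in corners l) = (p \in label_points l).
Proof. by rewrite /corners /ccw; case: ifP; rewrite // mem_rev. Qed.

Lemma corners_neq0 l : corners l != [::].
Proof. by case: l. Qed.

Lemma polygon_corners l :
  polygon R l = conv_hull [set` map (int_point R) (corners l)].
Proof.
congr conv_hull; apply/seteqP.
by split => _ /mapP [p pl ->]; rewrite /= map_f // ?mem_corners // -mem_corners.
Qed.

Lemma polygon_region l : polygon R l = region (facets l).
Proof.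
rewrite polygon_corners; have /and5P [cF _ polF _ _] := label_okP l.
exact: hull_region cF (corners_neq0 l) polF.
Qed.

Lemma polar_swap s t : all (polar t) s -> all (polar s) t.
Proof.
move=> /allP st; apply/allP => u ut; apply/allP => p ps.
by rewrite dotC; exact: (allP (st _ ps)).
Qed.

Lemma facets_neq0 l : facets l != [::].
Proof. by case: l. Qed.

(** The dual is cut out by the corners, and corners and facets satisfy the
    hypotheses of [hull_region] with their parts exchanged. *)
Lemma dual_polygon l : dual_polytope (polygon R l) =
  conv_hull [set` map (fun u => (int_point R u)^T) (facets l)].
Proof.
have /and5P [_ cC polF _ _] := label_okP l.
have H := hull_region R cC (facets_neq0 l) (polar_swap polF).
rewrite (map_comp trmx (int_point R)) -image_map_seq hull_image H.
apply/seteqP; split => [y hy|_ [x hx <-] z].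
  exists y^T; last by rewrite /= trmxK.
  move=> p pc; rewrite -pairing_int_point; apply: hy.
  by rewrite polygon_corners; apply: hull_gen; rewrite /= map_f.
rewrite polygon_corners.
have cvx : mix_closed [set z : 'rV[R]_2 | -1 <= pairing z x^T].
  move=> a b r /=; rewrite /pairing mulmxDl -!scalemxAl !mxE => ha hb r01.
  by nra.
apply: (hull_sub cvx) => _ /mapP [p pc ->] /=.
by rewrite pairing_int_point trmxK; exact: hx.
Qed.

(** The facets decide membership, and the corners bound the coordinates, so that
    no lattice point falls outside of the square that was searched. *)
Lemma mem_lattice_points l p :
  polygon R l (int_point R p) <-> p \in lattice_points l.
Proof.
have region_polar : region (facets l) (int_point R p) <-> polar (facets l) p.
  split => [h|/allP h u uF].
    apply/allP => u /h; rewrite lin_form_int_point dotC.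
    by rewrite -(mulrN1z 1) ler_int.
  by rewrite lin_form_int_point dotC -(mulrN1z 1) ler_int; exact: h.
rewrite mem_filter; split => [h|/andP [h _]]; last first.
  by rewrite polygon_region; apply/region_polar.
apply/andP; split; first by apply/region_polar; rewrite -polygon_region.
have /and5P [_ _ _ /allP box _] := label_okP l.
have bound u : (forall c, c \in corners l -> -3 <= dot c u) -> -3 <= dot p u.
  move=> hu; rewrite -(ler_int R) -lin_form_int_point; move: h.
  rewrite polygon_corners.
  apply: (@hull_sub _ _ _ [set x | (-3)%:~R <= lin_form u x]).
    move=> a b r /= ha hb r01; rewrite lin_form_mix; nra.
  by move=> _ /mapP [c cc ->] /=; rewrite lin_form_int_point ler_int hu.
have inbox c :
  c \in corners l -> [&& -3 <= c.1, c.1 <= 3, -3 <= c.2 & c.2 <= 3].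
  by move=> /box; rewrite mem_square.
rewrite mem_square; apply/and4P; split.
- have := bound (1, 0); rewrite /dot /= => H.
  suff : -3 <= p.1 * 1 + p.2 * 0 by lia.
  by apply: H => -[c1 c2] /inbox /=; lia.
- have := bound (-1, 0); rewrite /dot /= => H.
  suff : -3 <= p.1 * -1 + p.2 * 0 by lia.
  by apply: H => -[c1 c2] /inbox /=; lia.
- have := bound (0, 1); rewrite /dot /= => H.
  suff : -3 <= p.1 * 0 + p.2 * 1 by lia.
  by apply: H => -[c1 c2] /inbox /=; lia.
- have := bound (0, -1); rewrite /dot /= => H.
  suff : -3 <= p.1 * 0 + p.2 * -1 by lia.
  by apply: H => -[c1 c2] /inbox /=; lia.
Qed.

Lemma card_seq_set (T : eqType) (s : seq T) : uniq s -> [set` s] #= `I_(size s).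
Proof.
move=> us; case sE: s => [|x0 s']; first by rewrite set_nil II0.
rewrite -sE; have -> : [set` s] = nth x0 s @` `I_(size s).
  apply/seteqP; split => [x xs|_ [i /= il <-]]; last exact: mem_nth.
  by exists (index x s); [rewrite /= index_mem|exact: nth_index].
apply: inj_card_eq => i j /set_mem /= il /set_mem /= jl E.
by apply/eqP; rewrite -(nth_uniq x0 il jl us) E.
Qed.

(** A nonzero lattice point [p] lies on a facet, which excludes the point
    [p + d p] for every [d > 0]; so [p] is not interior. *)
Lemma boundary_points l : boundary (polygon R l) `&` Z2 R =
  [set` map (int_point R) [seq p <- lattice_points l | p != 0]].
Proof.
have /and5P [_ _ _ _ /and3P [_ /allP bd _]] := label_okP l.
have cl : closure (polygon R l) = polygon R l.
  by rewrite polygon_region; apply/esym/closure_id; exact: region_closed.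
apply/seteqP; split => [x [[Px nPx] Zx]|_ /mapP [p pl ->]].
  rewrite cl in Px; rewrite Z2E in Zx; case: Zx Px nPx => p _ <- Px nPx.
  rewrite /= map_f // mem_filter; apply/andP; split; last first.
    exact/mem_lattice_points.
  apply: contra_notN nPx => /eqP ->; rewrite int_point0 polygon_region.
  exact: region_nbhs0.
move: pl; rewrite mem_filter => /andP [p0 pl].
split; last by rewrite Z2E; exists p.
split; first by rewrite cl; apply/mem_lattice_points.
move=> /(nbhs_ray (int_point R p)) [d d0].
have := bd _ pl; rewrite (negPf p0) /= => /hasP [u uF /eqP pu].
rewrite polygon_region => /(_ _ uF).
by rewrite -[X in X + _]scale1r lin_form_mix lin_form_int_point pu; lra.
Qed.

Lemma mem_lattice_points_basis l : exists2 e : int,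
  polygon R l (int_point R (0, 1)) & polygon R l (int_point R (1, e)).
Proof.
have /and5P [_ _ _ _ /and3P [_ _ /andP [p01 /orP [p1|p1]]]] := label_okP l.
  by exists 0; apply/mem_lattice_points.
by exists 1; apply/mem_lattice_points.
Qed.

Lemma polygon_two_dimensional l : two_dimensional (polygon R l).
Proof.
have [e p01 p1e] := mem_lattice_points_basis l.
exists 0, (int_point R (0, 1)), (int_point R (1, e)); split => //.
  by rewrite polygon_region; apply: interior_subset; exact: region_nbhs0.
have [|r1' [r2' E]] := @frame_mx_inverse R (0, 1) (1, e).
  by rewrite (_ : cross _ _ = -1) // /cross /=; lia.
have [uF _] := mulmx1_unit E; rewrite !subr0.
suff -> : col_mx (int_point R (0, 1)) (int_point R (1, e)) =
  frame_mx R (0, 1) (1, e) by exact: mxrank_unit.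
apply/row_matrixP => i; rewrite [in RHS]rowK.
case: i => -[|[|//]] ilt.
  rewrite (_ : Ordinal ilt = lshift 1 (0 : 'I_1)); last exact: val_inj.
  by rewrite (@rowKu _ 1 1) row_id.
rewrite (_ : Ordinal ilt = rshift 1 (0 : 'I_1)); last exact: val_inj.
by rewrite (@rowKd _ 1 1) row_id.
Qed.

Lemma polygon_reflexive l : reflexive_polygon (Z2 R, polygon R l).
Proof.
have /and5P [cC _ _ _ _] := label_okP l.
split.
- exact: is_lattice_Z2.
- split; first by eexists.
  by move=> v /vertex_gen /= /mapP [p _ ->]; rewrite Z2E; exists p.
- exact: polygon_two_dimensional.
- by rewrite polygon_region; exact: region_nbhs0.
- rewrite dual_polygon; split; first by eexists.
  move=> v /vertex_gen /= /mapP [u _ ->] x; rewrite Z2E => -[p _ <-].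
  by rewrite pairing_int_point trmxK lin_form_int_point intr_int.
Qed.

Lemma card_label_boundary l :
  boundary (polygon R l) `&` Z2 R #= `I_(label_number l).
Proof.
have /and5P [_ _ _ _ /and3P [/eqP <- _ _]] := label_okP l.
rewrite boundary_points -(size_map (int_point R)).
apply: card_seq_set; rewrite map_inj_uniq; last exact: int_point_inj.
rewrite !filter_uniq // /square allpairs_uniq ?iota_uniq //.
Qed.

(** The matrix of an isomorphism maps the standard basis into the integer
    points, so it acts on integer points as some [comb r1 r2], which then maps
    the lattice points of one polygon onto those of the other. *)
Lemma polygons_not_isomorphic l l' :
  isomorphic (Z2 R, polygon R l) (Z2 R, polygon R l') -> l = l'.
Proof.
move=> /(isomorphic_mx (is_lattice_Z2 R) (is_lattice_Z2 R)) [A uA [ZA PA]].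
have rowA p : exists q, int_point R p *m A = int_point R q.
  have : Z2 R (int_point R p *m A).
    by rewrite ZA; exists (int_point R p) => //; rewrite Z2E; exists p.
  by rewrite Z2E => -[q _ <-]; exists q.
have [r1 r1E] := rowA (1, 0); have [r2 r2E] := rowA (0, 1).
have mulA p : int_point R p *m A = int_point R (comb r1 r2 p).
  have -> : int_point R p =
      p.1%:~R *: int_point R (1, 0) + p.2%:~R *: int_point R (0, 1).
    by apply: row2_eq; rewrite !mxE /=; ring.
  rewrite mulmxDl -!scalemxAl r1E r2E.
  by apply: row2_eq; rewrite !mxE /= rmorphD !rmorphM.
have into p : p \in lattice_points l -> comb r1 r2 p \in lattice_points l'.
  move=> /(mem_lattice_points l) pl; apply/mem_lattice_points.
  by rewrite PA -mulA; exists (int_point R p).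
have onto q :
  q \in lattice_points l' -> q \in map (comb r1 r2) (lattice_points l).
  move=> /(mem_lattice_points l'); rewrite PA => -[x Px xE].
  have : Z2 R (int_point R q) by rewrite Z2E; exists q.
  rewrite ZA Z2E => -[_ [p _ <-] pE].
  have xp : x = int_point R p.
    rewrite -(mulmxK uA x) -(mulmxK uA (int_point R p)); congr (_ *m _).
    by rewrite /= in xE pE; rewrite xE pE.
  apply/mapP; exists p; first by apply/mem_lattice_points; rewrite -xp.
  by apply: (@int_point_inj R); rewrite -mulA -pE.
have same : same_lattice_points l l'.
  have /and5P [_ _ _ _ /and3P [_ _ /andP [p01 p1]]] := label_okP l.
  have [e] : exists2 e : int * int, e \in [:: (1, 0); (1, 1)] &
      e.1 = 1 /\ e \in lattice_points l.
    by case/orP: p1 => pl; [exists (1, 0)|exists (1, 1)].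
  move=> eB [e1 el]; apply/hasP; exists e => //; rewrite el /=.
  apply/hasP; exists (comb r1 r2 (0, 1)); first exact: into.
  apply/hasP; exists (comb r1 r2 e); first exact: into.
  rewrite (_ : (_, _) = r1); last by apply: vec_eq => /=; rewrite e1; ring.
  rewrite (_ : comb r1 r2 (0, 1) = r2); last by apply: vec_eq => /=; ring.
  apply/andP; split; last by apply/allP => q /onto.
  by apply/allP => _ /mapP [p pl ->]; exact: into.
have /allP /(_ _ (mem_labels l')) := allP labels_distinct _ (mem_labels l).
by rewrite same => /eqP.
Qed.

End Labels.

(** * Integer data of a reflexive polygon *)

Section IntegerData.
Variable R : realType.

Lemma map_preimage (T U : eqType) (f : T -> U) (s : seq U) :
  (forall v, v \in s -> exists p, v = f p) -> exists V, s = map f V.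
Proof.
elim: s => [|v s IH] h; first by exists [::].
have [p ->] := h v (mem_head _ _).
have [|V ->] := IH; last by exists (p :: V).
by move=> w ws; apply: h; rewrite inE ws orbT.
Qed.

Lemma seq_bound (T : eqType) (f : T -> R) (s : seq T) :
  exists2 K, 0 < K & forall z, z \in s -> f z <= K.
Proof.
elim: s => [|v s [K K0 h]]; first by exists 1.
exists (K + `|f v|); first by rewrite ltr_wpDr.
move=> z; rewrite inE => /orP[/eqP->|/h zK].
  by rewrite (le_trans (ler_norm _)) // lerDr ltW.
by rewrite (le_trans zK) // lerDl.
Qed.

Lemma pairing_tr_le0 (x : 'rV[R]_2) : pairing x x^T <= 0 -> x = 0.
Proof.
rewrite /pairing mxE sum_ord2 !mxE => h.
have h0 := sqr_ge0 (x 0 0); have h1 := sqr_ge0 (x 0 1); rewrite !expr2 in h0 h1.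
apply: row2_eq; rewrite mxE; apply/eqP; rewrite -sqrf_eq0 expr2; apply/eqP;
  lra.
Qed.

Lemma pairingZl (a : R) x (y : 'cV[R]_2) : pairing (a *: x) y = a * pairing x y.
Proof. by rewrite /pairing -scalemxAl mxE. Qed.

Lemma pairingZr (a : R) (x : 'rV[R]_2) y : pairing x (a *: y) = a * pairing x y.
Proof. by rewrite /pairing -scalemxAr mxE. Qed.

Lemma mix_pairingl (a : R) (y : 'cV[R]_2) :
  mix_closed [set x | a <= pairing x y].
Proof.
move=> b c r /= hb hc r01.
by rewrite /pairing mulmxDl mxE -!/(pairing _ _) !pairingZl; nra.
Qed.

Lemma mix_pairingr (a : R) (x : 'rV[R]_2) :
  mix_closed [set y | a <= pairing x y].
Proof.
move=> b c r /= hb hc r01.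
by rewrite /pairing mulmxDr mxE -!/(pairing _ _) !pairingZr; nra.
Qed.

(** Coordinates in a basis [B] of the lattice turn [P] into the hull of [V], and
    the inverse of [B] turns the dual into the hull of [U]. A form that is
    nonnegative on [V] is nonnegative on [P], hence also at a small negative
    multiple of its own coefficient vector, since [0] is interior to [P]; so it
    vanishes. The same works for [U] because [P] is bounded, which puts small
    multiples of any form in the dual. *)
Lemma reflexive_data (MP : lattice_pair R) : reflexive_polygon MP ->
  exists V U, [/\ positively_spanning V, positively_spanning U,
    forall u, u \in U -> polar V u &
    isomorphic MP (Z2 R, conv_hull [set` map (int_point R) V])].
Proof.
case: MP => M P [[B uB ME] [[s0 Ps0] vM] _ P0 [[t0 Dt0] vD]].
have [s Ps vs] := hull_vertices s0; rewrite -Ps0 in Ps vs.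
have [t Dt vt] := hull_vertices t0; rewrite -Dt0 in Dt vt.
have [V sV] : exists V, s = map (fun p => int_point R p *m B) V.
  apply: map_preimage => v /vs /vM.
  by rewrite ME integer_spanE => -[p _ <-]; exists p.
have [U tU] : exists U, t = map (fun u => invmx B *m (int_point R u)^T) U.
  apply: map_preimage => y /vt /vD yM.
  have Mp p : M (int_point R p *m B) by rewrite ME integer_spanE; exists p.
  have /intrP [a aE] := yM _ (Mp (1, 0)).
  have /intrP [b bE] := yM _ (Mp (0, 1)).
  exists (a, b); apply: (canRL (mulKmx uB)).
  move: aE bE; rewrite /pairing -!mulmxA -!/(pairing _ _) !pairing_int_point.
  rewrite /lin_form /= => aE bE; apply: trmx_inj; rewrite trmxK.
  apply: row2_eq; rewrite [RHS]mxE /= -?aE -?bE; ring.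
have pairE p u : pairing (int_point R p *m B) (invmx B *m (int_point R u)^T) =
                 (dot p u)%:~R.
  rewrite /pairing mulmxA mulmxK // -/(pairing _ _) pairing_int_point trmxK.
  by rewrite lin_form_int_point dotC.
have PV p : p \in V -> P (int_point R p *m B).
  move=> pV; rewrite Ps; apply: hull_gen; rewrite /= sV.
  by apply/mapP; exists p.
have DU u : u \in U -> dual_polytope P (invmx B *m (int_point R u)^T).
  move=> uU; rewrite Dt; apply: hull_gen; rewrite /= tU.
  by apply/mapP; exists u.
exists V, U; split.
- move=> c hc; pose y := invmx B *m (int_point R c)^T.
  have yge0 : P `<=` [set x | 0 <= pairing x y].
    rewrite Ps; apply: hull_sub; first exact: mix_pairingl.
    by rewrite sV => _ /mapP [p pV ->] /=; rewrite pairE ler0z; exact: hc.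
  have [d d0 /yge0 /=] := nbhs_ray (- y^T) P0.
  rewrite add0r pairingZl -scaleN1r pairingZl pmulr_rge0 // mulN1r oppr_ge0.
  rewrite -{2}[y]trmxK => /pairing_tr_le0 y0; apply: (@int_point_inj R).
  rewrite int_point0; apply: trmx_inj; rewrite trmx0.
  rewrite -(mulKVmx uB (int_point R c)^T).
  by rewrite -/y -[y]trmxK y0 trmx0 mulmx0.
- move=> c hc; pose x := int_point R c *m B.
  have xge0 : dual_polytope P `<=` [set y | 0 <= pairing x y].
    rewrite Dt; apply: hull_sub; first exact: mix_pairingr.
    by rewrite tU => _ /mapP [u uU ->] /=; rewrite pairE ler0z dotC; exact: hc.
  have [K K0 sK] := seq_bound (fun z => pairing z x^T) s.
  have /xge0 /= : dual_polytope P (- K^-1 *: x^T).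
    suff H : P `<=` [set z | -1 <= pairing z (- K^-1 *: x^T)] by move=> z /H.
    rewrite Ps; apply: hull_sub; first exact: mix_pairingl.
    move=> z /= /sK zK; rewrite pairingZr mulNr lerN2 mulrC ler_pdivrMr //.
    by rewrite mul1r.
  rewrite pairingZr mulNr oppr_ge0 pmulr_rle0 ?invr_gt0 //.
  move=> /pairing_tr_le0 x0.
  apply: (@int_point_inj R); rewrite int_point0 -(mulmxK uB (int_point R c)).
  by rewrite -/x x0 mul0mx.
- move=> u /DU hu; apply/allP => p /PV /hu.
  by rewrite pairE -(mulrN1z 1) ler_int.
- have := @mx_isomorphic R (invmx B) M P; rewrite unitmx_inv => /(_ uB).
  rewrite Ps -hull_image image_map_seq.
  have -> : map (mulmxr (invmx B)) s = map (int_point R) V.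
    by rewrite sV -map_comp; apply: eq_map => p /=; rewrite mulmxK.
  suff -> : mulmxr (invmx B) @` M = Z2 R by [].
  rewrite ME integer_spanE Z2E; apply/seteqP.
  split => [_ [_ [p _ <-] <-]|_ [p _ <-]].
    by exists p => //=; rewrite mulmxK.
  by exists (int_point R p *m B); [exists p|rewrite /= mulmxK].
Qed.

End IntegerData.

(** * The classification *)

Lemma mem_bitseqs m : m \in bitseqs (size m).
Proof.
elim: m => [|b m IH] //; apply/allpairsP; exists (b, m); split => //.
by case: b.
Qed.

Lemma mask_le_indicator L s f : mask_le (indicator L s) [seq f p | p <- L] ->
  forall p, p \in L -> p \in s -> f p.
Proof.
rewrite /mask_le /indicator all2E !size_map eqxx /= => /allP h p pL ps.
have := h (p \in s, f p); rewrite ps /=; apply.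
elim: (L) pL => // q L' IH; rewrite !inE /= => /orP [/eqP<-|/IH].
  by rewrite ps eqxx.
by move=> ->; rewrite orbT.
Qed.

Lemma mem_candidates m p : m \in minimal_labels -> p != 0 ->
  polar (label_points m) p -> p \in candidates m.
Proof.
move=> mm p0 pp; rewrite mem_filter p0 pp /= mem_square.
move: mm pp; rewrite !inE => /or3P [] /eqP-> /=; case: p p0 => p1 p2 _;
  rewrite /dot /=; lia.
Qed.

(** The two inclusions give [V] and the image of the corners of [l] the same
    convex hull; the point [0], on which masks say nothing, is in it anyway. *)
Lemma classification V m : m \in minimal_labels -> positively_spanning V ->
  (forall p, p \in V -> polar (label_points m) p) ->
  exists l r1 r2, [/\ cross r1 r2 ^+ 2 = 1,
    {subset map (comb r1 r2) (corners l) <= V} &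
    forall p, p \in V -> p != 0 -> p \in map (comb r1 r2) (lattice_points l)].
Proof.
move=> mm spanV Vm; set L := candidates m.
have LV p : p \in V -> p != 0 -> p \in L.
  by move=> pV p0; apply: mem_candidates => //; exact: Vm.
have := allP minimal_classified _ (map_f candidates mm).
rewrite -/L /classified_over.
have -> : size L = size (indicator L V) by rewrite size_map.
move=> /allP /(_ _ (mem_bitseqs _)) /orP [/hasP [h]|/hasP [[m1 m2]]].
  rewrite mem_undup => /mapP [c]; rewrite mem_filter => /andP [c0 _] ->.
  move=> /mask_le_indicator hc; case/eqP: c0; apply: spanV => p pV.
  have [->|p0] := eqVneq p 0; first by rewrite /dot /= !mul0r.
  by apply: hc => //; exact: LV.
rewrite mem_undup => /flattenP [_ /mapP [l _ ->] /mapP [[r1 r2]]].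
rewrite mem_filter => /andP [/allP /= cL].
rewrite mem_filter => /andP [r12 _] [-> ->] /= /andP [].
move=> /mask_le_indicator s1 /mask_le_indicator s2.
exists l, r1, r2; split.
- by case/orP: r12 => /eqP ->.
- by move=> _ /mapP [c cl ->]; apply: s1; [exact: cL|exact: map_f].
- by move=> p pV p0; apply: s2 => //; exact: LV.
Qed.

(** In the coordinates of the frame [v], [w], the points [label_points m] belong
    to the dual polygon, so that the vertices of the polygon satisfy the
    inequalities that they define and [classification] applies. *)
Lemma reflexive_classified (R : realType) (MP : lattice_pair R) :
  reflexive_polygon MP ->
  exists l, isomorphic MP (Z2 R, polygon R l).
Proof.
move=> rMP; have [V [U [spanV spanU VU iso1]]] := reflexive_data rMP.
have [v [w [m [vw mm mV]]]] := polar_contains_minimal spanV spanU VU.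
pose V1 := map (frame_coord v w) V.
have spanV1 : positively_spanning V1.
  move=> c hc; suff /vec_eq0 [/= e1 e2] : comb v w c = 0.
    have E1 : cross v w ^+ 2 * c.1 = cross v w * (cross (comb v w c) w).
      by rewrite /cross /comb /=; ring.
    have E2 : cross v w ^+ 2 * c.2 = cross v w * (cross v (comb v w c)).
      by rewrite /cross /comb /=; ring.
    apply: vec_eq; rewrite /= -[LHS]mul1r -vw ?E1 ?E2 /cross /= e1 e2; ring.
  by apply: spanV => p pV; rewrite -dot_frame_coord; apply: hc; rewrite map_f.
have V1m p : p \in V1 -> polar (label_points m) p.
  move=> /mapP [q qV ->]; apply/allP => c cm; rewrite dotC dot_frame_coord.
  by have /allP := mV _ cm; apply.
have [l [r1 [r2 [r12 cV pV]]]] := classification mm spanV1 V1m.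
exists l.
have iso2 : isomorphic (Z2 R, conv_hull [set` map (int_point R) V])
                       (Z2 R, conv_hull [set` map (int_point R) V1]).
  have -> : V1 = map (comb (v.1, w.1) (v.2, w.2)) V.
    apply: eq_map => p; rewrite /frame_coord /comb /dot; apply: vec_eq => //.
  by apply: isomorphic_frame; rewrite -vw /cross /=; ring.
have iso3 : isomorphic (Z2 R, polygon R l)
                       (Z2 R, conv_hull [set` map (int_point R) V1]).
  rewrite polygon_corners; have := isomorphic_frame R (corners l) r12.
  suff -> : conv_hull [set` map (int_point R) (map (comb r1 r2) (corners l))] =
            conv_hull [set` map (int_point R) V1] by [].
  apply/seteqP; split.
    by apply: hull_mono => _ /mapP [p /cV pV1 ->]; rewrite /= map_f.
  apply: hull_sub; first exact: hull_mix.
  have E : conv_hull [set` map (int_point R) (map (comb r1 r2) (corners l))] =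
      mulmxr (frame_mx R r1 r2) @` polygon R l.
    rewrite polygon_corners -hull_image image_map_seq.
    suff -> : map (mulmxr (frame_mx R r1 r2)) (map (int_point R) (corners l)) =
              map (int_point R) (map (comb r1 r2) (corners l)) by [].
    by rewrite -!map_comp; apply: eq_map => p /=; rewrite mul_frame_mx.
  rewrite E => _ /mapP [p /pV pV' ->]; have [->|/pV'] := eqVneq p 0.
    exists 0; last by rewrite int_point0 /= mul0mx.
    by rewrite polygon_region; apply: interior_subset; exact: region_nbhs0.
  move=> /mapP [q ql ->].
  exists (int_point R q); first exact/mem_lattice_points.
  by rewrite /= mul_frame_mx.
apply: isomorphic_trans iso1 _; apply: isomorphic_trans iso2 _.
by apply: isomorphic_sym iso3; exact: is_lattice_Z2.
Qed.

Lemma iso_classes_range (R : realType) :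
  iso_classes R =
  (fun i => iso_class (Z2 R, polygon R (nth L3 labels i))) @` `I_16.
Proof.
apply/seteqP; split => [_ [MP rMP <-]|_ [i _ <-]]; last first.
  by exists (Z2 R, polygon R (nth L3 labels i)) => //; exact: polygon_reflexive.
have [l ml] := reflexive_classified rMP.
exists (label_index l); first by case: (l).
have -> : nth L3 labels (label_index l) = l by case: (l).
have latt (MP' : lattice_pair R) : reflexive_polygon MP' -> is_lattice MP'.1.
  by case: MP' => M P [].
have lm := isomorphic_sym (latt _ rMP) (latt _ (polygon_reflexive R l)) ml.
apply/seteqP; split => MP' [rMP' iMP']; split => //.
  exact: isomorphic_trans ml iMP'.
exact: isomorphic_trans lm iMP'.
Qed.

Lemma card_iso_classes (R : realType) : iso_classes R #= `I_16.
Proof.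
rewrite iso_classes_range; apply: inj_card_eq => i j.
move=> /set_mem /= il /set_mem /= jl E.
have : iso_class (Z2 R, polygon R (nth L3 labels j))
                 (Z2 R, polygon R (nth L3 labels j)).
  by split; [exact: polygon_reflexive|exact: isomorphic_refl].
rewrite -E => -[_ /polygons_not_isomorphic /(congr1 label_index)].
have nthK k : (k < 16)%N -> label_index (nth L3 labels k) = k.
  by do 16! [case: k => [|k] //].
by rewrite !nthK.
Qed.

Theorem proposition4p1 (R : realType) :
  [/\ iso_classes R #= `I_16,
      forall l : label, reflexive_polygon (Z2 R, polygon R l),
      forall l l' : label,
        isomorphic (Z2 R, polygon R l) (Z2 R, polygon R l') -> l = l',
      forall MP : lattice_pair R, reflexive_polygon MP ->
        exists l : label, isomorphic MP (Z2 R, polygon R l)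
    & forall l : label,
        boundary (polygon R l) `&` Z2 R #= `I_(label_number l)].
Proof.
split.
- exact: card_iso_classes.
- exact: polygon_reflexive.
- exact: polygons_not_isomorphic.
- exact: reflexive_classified.
- exact: card_label_boundary.
Qed.
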